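(* Let $A=(A,d,\cdot\,)$ be a differential graded associative algebra over a field $\Bbbk$, with cohomology algebra $H=H(A,d)$, and let $x,y,z\in H$ be homogeneous with $x\cdot y=y\cdot z=0$. Then the equivalence class $[\langle x,y,z\rangle]$ of the triple Massey product and the equivalence class $[\mu_3(x,y,z)]$ of the value of any canonical ternary product $\mu_3$ of $A$ satisfy $$[\langle x,y,z\rangle]=(-1)^{|y|}\cdot[\mu_3(x,y,z)]\quad\text{in}\quad \frac{H^{|x|+|y|+|z|-1}}{\big(x\cdot H^{|y|+|z|-1}+H^{|x|+|y|-1}\cdot z\big)} .$$
   Context: All objects are over a field $\Bbbk$; complexes are cochain complexes (differentials of degree $+1$), possibly unbounded; $[a]$ denotes the cohomology class of a cocycle $a$ or the class of an element in a quotient; $\overline a:=(-1)^{|a|}a$. Koszul sign rule is used when evaluating tensor products of maps on elements. The product on $H$ is the one induced by the product of $A$. Triple Massey product. For homogeneous $x,y,z\in H$ with $x\cdot y=y\cdot z=0$, a defining system for $\langle x,y,z\rangle$ is a collection $D$ of homogeneous elements $a_{1,1},a_{2,2},a_{3,3},a_{1,2},a_{2,3}\in A$ such that $a_{1,1},a_{2,2},a_{3,3}$ are cocycles with $[a_{1,1}]=x$, $[a_{2,2}]=y$, $[a_{3,3}]=z$, and $a_{1,2},a_{2,3}$ are cochains of degrees $|x|+|y|-1$ and $|y|+|z|-1$ with $d a_{1,2}=\overline a_{1,1}\cdot a_{2,2}$, $d a_{2,3}=\overline a_{2,2}\cdot a_{3,3}$. Put $c(D):=\overline a_{1,1}\cdot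 a_{2,3}+\overline a_{1,2}\cdot a_{3,3}\in A^{|x|+|y|+|z|-1}$. Then $\langle x,y,z\rangle\subset H^{|x|+|y|+|z|-1}$ is the set of all $[c(D)]$, with $D$ running over all defining systems. All elements of $\langle x,y,z\rangle$ have the same class modulo $x\cdot H^{|y|+|z|-1}+H^{|x|+|y|-1}\cdot z$; this class is denoted $[\langle x,y,z\rangle]$. An $A_\infty$-algebra $(A,d,\mu_2,\mu_3,\ldots)$ is a cochain complex $(A,d)$ with linear maps $\mu_n:A^{\otimes n}\to A$ of degree $2-n$, $n\ge2$, such that for all $n\ge 2$ $$\delta(\mu_n)=\sum (-1)^{i(l+1)+n}\,\mu_k\big(\mathrm{id}^{\otimes (i-1)}\otimes\mu_l\otimes \mathrm{id}^{\otimes (k-i)}\big),$$ the sum over $k,l\ge2$, $k+l=n+1$, $1\le i\le k$, where $\delta(f)=d\circ f-(-1)^{|f|}f\circ d$. A dg algebra is viewed as the $A_\infty$-algebra with $\mu_2=\cdot$ and $\mu_n=0$ for $n\ge3$. An $A_\infty$-morphism $\vartheta_\infty=(\vartheta,\vartheta_2,\vartheta_3,\ldots):(A,d,\mu_2,\ldots)\to(B,d,\nu_2,\ldots)$ consists of a cochain map $\vartheta=\vartheta_1:A\to B$ and linear maps $\vartheta_n:A^{\otimes n}\to B$ of degree $1-n$, $n\ge2$, such that for all $n\ge2$ $$\delta(\vartheta_n)+\sum_{k\ge2,\ r_1+\cdots+r_k=n,\ r_j\ge1}(-1)^{\sum_{i<j}r_i(r_j+1)}\nu_k(\vartheta_{r_1}\otimes\cdots\otimes\vartheta_{r_k})=\vartheta\circ\mu_n-\sum(-1)^{i(l+1)+n}\vartheta_k\big(\mathrm{id}^{\otimes(i-1)}\otimes\mu_l\otimes\mathrm{id}^{\otimes(k-i)}\big),$$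 the last sum over $k,l\ge2$, $k+l=n+1$, $1\le i\le k$. A canonical minimal model of a dg algebra $A$ is an $A_\infty$-structure $(H,0,\mu_2,\mu_3,\ldots)$ on $H=H(A,d)$ for which there exists an $A_\infty$-morphism $\psi_\infty=(\psi,\psi_2,\ldots):(H,0,\mu_2,\mu_3,\ldots)\to(A,d,\cdot\,,0,0,\ldots)$ with $[\psi(h)]=h$ for each $h\in H$. A canonical $n$-ary product is the $n$th operation $\mu_n:H^{\otimes n}\to H$ of some canonical minimal model of $A$. If $x\cdot y=y\cdot z=0$, the class of $\mu_3(x,y,z)$ modulo $x\cdot H^{|y|+|z|-1}+H^{|x|+|y|-1}\cdot z$ is the same for all canonical ternary products $\mu_3$; it is denoted $[\mu_3(x,y,z)]$. *)

(* Defs.v *)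
From HB Require Import structures.
From mathcomp Require Import all_boot all_order all_algebra.
From mathcomp Require Import zify boolp classical_sets.

Set Implicit Arguments.
Unset Strict Implicit.
Unset Printing Implicit Defensive.

Import GRing.Theory.
Local Open Scope ring_scope.
Local Open Scope quotient_scope.

Section Subquotient.
Variables (K : fieldType) (V : lmodType K) (Z B : submodClosed V).

Record submod := Submod { submod_val : V; submod_valP : submod_val \in Z }.
HB.instance Definition _ := [isSub for submod_val].
HB.instance Definition _ := [Choice of submod by <:].
HB.instance Definition _ := [SubChoice_isSubLmodule of submod by <:].

Lemma submod_val0 : submod_val 0 = 0. Proof. exact: (raddf0 val). Qed.
Lemma submod_valD u v : submod_val (u + v) = submod_val u + submod_val v.
Proof. exact: (raddfD val). Qed.
Lemma submod_valB u v : submod_val (u - v) = submod_val u - submod_val v.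
Proof. exact: (raddfB val). Qed.
Lemma submod_valZ a u : submod_val (a *: u) = a *: submod_val u.
Proof. exact: (linearZ_LR val). Qed.

Definition submod_in : {pred submod} := fun u => submod_val u \in B.

Lemma submod_in_closed : submod_closed submod_in.
Proof.
have inE' u : (u \in submod_in) = (submod_val u \in B) by rewrite unfold_in.
split=> [|a u v]; rewrite !inE' ?submod_val0 ?rpred0 // => hu hv.
by rewrite submod_valD submod_valZ rpredD // rpredZ.
Qed.
HB.instance Definition _ := GRing.isSubmodClosed.Build K submod submod_in
  submod_in_closed.

(* The quotient Z / (Z ∩ B). *)
Definition subquot : Type := {ideal_quot submod_in}.
HB.instance Definition _ := GRing.Zmodule.on subquot.
HB.instance Definition _ := Quotient.on subquot.

Definition subquot_scale (a : K) (u : subquot) : subquot :=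
  \pi_subquot (a *: repr u).

Lemma subquot_eq (u v : submod) :
  (\pi_subquot u = \pi_subquot v) <-> submod_val u - submod_val v \in B.
Proof.
have -> : (submod_val u - submod_val v \in B) = (u - v \in submod_in).
  by rewrite [RHS]unfold_in submod_valB.
by rewrite Quotient.idealrBE; split=> [/eqP|/eqP].
Qed.

Lemma subquot_piD (u v : submod) :
  \pi_subquot (u + v) = \pi_subquot u + \pi_subquot v.
Proof. exact: Quotient.pi_add. Qed.

Lemma subquot_piZ a (u : submod) :
  \pi_subquot (a *: u) = subquot_scale a (\pi_subquot u).
Proof.
apply/subquot_eq; rewrite !submod_valZ -scalerBr rpredZ //.
by apply/subquot_eq; rewrite reprK.
Qed.

Let pi_ex (u : subquot) : exists w, u = \pi_subquot w.
Proof. by exists (repr u); rewrite reprK. Qed.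
Let scaleA a b (u : subquot) :
  subquot_scale a (subquot_scale b u) = subquot_scale (a * b) u.
Proof. by case: (pi_ex u) => w ->; rewrite -!subquot_piZ scalerA. Qed.
Let scale1 : left_id 1 subquot_scale.
Proof. by move=> u; case: (pi_ex u) => w ->; rewrite -subquot_piZ scale1r. Qed.
Let scaleDr : right_distributive subquot_scale +%R.
Proof.
move=> a u v; case: (pi_ex u) => {}u ->; case: (pi_ex v) => {}v ->.
by rewrite -subquot_piD -!subquot_piZ -subquot_piD scalerDr.
Qed.
Let scaleDl (u : subquot) : {morph subquot_scale^~ u : a b / a + b}.
Proof.
move=> a b; case: (pi_ex u) => w ->.
by rewrite -!subquot_piZ -subquot_piD scalerDl.
Qed.
HB.instance Definition _ := GRing.Zmodule_isLmodule.Build K subquot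
  scaleA scale1 scaleDr scaleDl.

(* The class [v]; only meaningful for v \in Z, and 0 by convention otherwise. *)
Definition cls (v : V) : subquot := \pi_subquot (insubd (0 : submod) v).

Lemma clsE v (hv : v \in Z) : cls v = \pi_subquot (Submod hv).
Proof.
rewrite /cls; congr (\pi_subquot _); apply: val_inj.
by rewrite val_insubd hv.
Qed.

Lemma cls_eq u v : u \in Z -> v \in Z -> (cls u = cls v) <-> u - v \in B.
Proof. by move=> hu hv; rewrite !clsE; apply: subquot_eq. Qed.

Lemma cls_eq0 u : u \in Z -> (cls u = 0) <-> u \in B.
Proof.
move=> hu; have -> : 0 = cls 0.
  rewrite (clsE (rpred0 Z)); have -> : Submod (rpred0 Z) = 0.
    by apply: val_inj; rewrite raddf0.
  exact/esym/(@pi_zeror _ _ _ _ _ subquot).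
by rewrite cls_eq ?rpred0 // subr0.
Qed.

Lemma clsD u v : u \in Z -> v \in Z -> cls (u + v) = cls u + cls v.
Proof.
move=> hu hv; rewrite (clsE hu) (clsE hv) (clsE (rpredD hu hv)) -subquot_piD.
by congr (\pi_subquot _); apply: val_inj; rewrite raddfD.
Qed.

Lemma clsZ a u : u \in Z -> cls (a *: u) = a *: cls u.
Proof.
move=> hu; rewrite (clsE hu) (clsE (rpredZ a hu)).
rewrite -[RHS]/(subquot_scale _ _) -subquot_piZ.
by congr (\pi_subquot _); apply: val_inj; rewrite linearZ.
Qed.

Lemma cls_surj h : exists2 u, u \in Z & h = cls u.
Proof.
exists (val (repr h)); first exact: valP.
by rewrite (clsE (valP _)) -[LHS]reprK; congr (\pi_subquot _); apply: val_inj.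
Qed.

End Subquotient.

Lemma sgnK (K : fieldType) (V : lmodType K) (p : int) (v : V) :
  (-1) ^ p *: ((-1) ^ p *: v) = v.
Proof. by rewrite scalerA -expfzMl mulrNN mulr1 exp1rz scale1r. Qed.

Lemma sgnD (K : fieldType) (p q : int) :
  (-1 : K) ^ (p + q) = (-1) ^ p * (-1) ^ q.
Proof. by rewrite expfzDr // oppr_eq0 oner_eq0. Qed.
Lemma sgn1 (K : fieldType) : (-1 : K) ^ (-1 : int) = -1.
Proof. by rewrite exprN1 invrN1. Qed.


(* A graded vector space, as an internal direct sum of its components gr p. *)
Record gmod (K : fieldType) := Gmod {
  gmod_sort :> lmodType K;
  gr : int -> submodClosed gmod_sort;
  gr_span : forall v : gmod_sort,
    exists (s : seq int) (f : int -> gmod_sort),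
      [/\ uniq s, forall p, f p \in gr p & v = \sum_(p <- s) f p];
  gr_indep : forall (s : seq int) (f : int -> gmod_sort),
    uniq s -> (forall p, f p \in gr p) -> \sum_(p <- s) f p = 0 ->
    forall p, p \in s -> f p = 0
}.

Record complex (K : fieldType) := Complex {
  complex_gmod :> gmod K;
  diff : {linear complex_gmod -> complex_gmod};
  diff_gr : forall p a, a \in gr complex_gmod p ->
    diff a \in gr complex_gmod (p + 1);
  diffK : forall a, diff (diff a) = 0
}.
Arguments diff {K c}.

Section Cohomology.
Variables (K : fieldType) (C : complex K).

Definition cocycles : {pred C} := fun a => diff a == 0.
Definition boundaries : {pred C} := fun a => `[< exists b, a = diff b >].

Lemma cocyclesP a : reflect (diff a = 0) (a \in cocycles).
Proof. by rewrite unfold_in; apply: eqP. Qed.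
Lemma boundariesP a : reflect (exists b, a = diff b) (a \in boundaries).
Proof. by rewrite unfold_in; apply: asboolP. Qed.

Lemma cocycles_closed : submod_closed cocycles.
Proof.
split=> [|k a b /cocyclesP ha /cocyclesP hb]; apply/cocyclesP.
  by rewrite raddf0.
by rewrite linearP ha hb scaler0 addr0.
Qed.
HB.instance Definition _ :=
  GRing.isSubmodClosed.Build K C cocycles cocycles_closed.

Lemma boundaries_closed : submod_closed boundaries.
Proof.
split=> [|k a b /boundariesP[a' ->] /boundariesP[b' ->]]; apply/boundariesP.
  by exists 0; rewrite raddf0.
by exists (k *: a' + b'); rewrite linearP.
Qed.
HB.instance Definition _ :=
  GRing.isSubmodClosed.Build K C boundaries boundaries_closed.

Definition coh_sort : lmodType K := subquot cocycles boundaries.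

Definition coh_cls (a : C) : coh_sort := cls cocycles boundaries a.

Lemma coh_clsP (h : coh_sort) : exists2 a, diff a = 0 & h = coh_cls a.
Proof. by case: (cls_surj h) => a /cocyclesP; exists a. Qed.

Lemma coh_cls_eq a b : diff a = 0 -> diff b = 0 ->
  coh_cls a = coh_cls b <-> exists c, a - b = diff c.
Proof.
move=> /cocyclesP ha /cocyclesP hb.
by split=> [/(cls_eq _ ha hb)/boundariesP|/boundariesP/(cls_eq _ ha hb)].
Qed.

Lemma coh_clsP_lin k a b : diff a = 0 -> diff b = 0 ->
  coh_cls (k *: a + b) = k *: coh_cls a + coh_cls b.
Proof.
move=> /cocyclesP ha /cocyclesP hb.
by rewrite /coh_cls clsD ?rpredZ // clsZ.
Qed.

Lemma coh_cls0 : coh_cls 0 = 0.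
Proof. by apply/cls_eq0; apply: rpred0. Qed.

Lemma coh_cls_sum (s : seq int) (f : int -> C) : (forall p, diff (f p) = 0) ->
  coh_cls (\sum_(p <- s) f p) = \sum_(p <- s) coh_cls (f p).
Proof.
move=> hf; elim: s => [|p s IHs]; first by rewrite !big_nil coh_cls0.
rewrite !big_cons -IHs -[f p]scale1r coh_clsP_lin ?scale1r //.
by rewrite raddf_sum; apply: big1 => i _; apply: hf.
Qed.

Definition coh_gr (p : int) : {pred coh_sort} :=
  fun h => `[< exists a, [/\ a \in gr C p, diff a = 0 & h = coh_cls a] >].

Lemma coh_grP p h :
  reflect (exists a, [/\ a \in gr C p, diff a = 0 & h = coh_cls a])
    (h \in coh_gr p).
Proof. by rewrite unfold_in; apply: asboolP. Qed.

Lemma coh_gr_closed p : submod_closed (coh_gr p).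
Proof.
split=> [|k a b /coh_grP[a' [ga da ->]] /coh_grP[b' [gb db ->]]]; apply/coh_grP.
  by exists 0; rewrite rpred0 raddf0 coh_cls0.
exists (k *: a' + b'); rewrite rpredD ?rpredZ // linearP da db scaler0 addr0.
by rewrite coh_clsP_lin.
Qed.
HB.instance Definition _ p :=
  GRing.isSubmodClosed.Build K coh_sort (coh_gr p) (coh_gr_closed p).

Lemma gr_sum_eq (s t : seq int) (f g : int -> C) : uniq s -> uniq t ->
  (forall p, f p \in gr C p) -> (forall p, g p \in gr C p) ->
  (forall p, p \notin s -> f p = 0) -> (forall p, p \notin t -> g p = 0) ->
  \sum_(p <- s) f p = \sum_(p <- t) g p -> forall p, f p = g p.
Proof.
move=> us ut hf hg fs gt e p.
pose u := undup (s ++ t).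
have ext (v : seq int) (k : int -> C) : uniq v -> {subset v <= u} ->
    (forall p, p \notin v -> k p = 0) ->
    \sum_(p <- v) k p = \sum_(p <- u) k p.
  move=> uv vu kv.
  rewrite [RHS](bigID (mem v)) /= [X in _ + X]big1_seq; last first.
    by move=> i /andP[/kv].
  rewrite addr0 -[RHS]big_filter; apply: perm_big; apply: uniq_perm => //.
    by rewrite filter_uniq // undup_uniq.
  move=> i; rewrite mem_filter; case: (boolP (i \in v)) => //= /vu.
  by [].
have us' : {subset s <= u} by move=> i; rewrite mem_undup mem_cat => ->.
have ut' : {subset t <= u} by move=> i; rewrite mem_undup mem_cat orbC => ->.
rewrite (ext s f) // (ext t g) // in e.
case: (boolP (p \in u)) => pu; last first.
  by rewrite fs ?gt //; apply: contra pu => ?; [apply: ut'|apply: us'].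
apply/eqP; rewrite -subr_eq0; apply/eqP.
apply: (@gr_indep _ _ u (fun p => f p - g p)) pu => [|i|].
- exact: undup_uniq.
- by rewrite -scaleN1r rpredD ?rpredZ.
- by rewrite sumrB e subrr.
Qed.

Lemma gr_decomp (v : C) : exists (s : seq int) (f : int -> C),
  [/\ uniq s, forall p, f p \in gr C p, forall p, p \notin s -> f p = 0
    & v = \sum_(p <- s) f p].
Proof.
have [s [f [us hf ->]]] := gr_span v.
exists s, (fun p => if p \in s then f p else 0); split=> // [p|p /negPf->//|].
  by case: ifP => _ //; rewrite rpred0.
by apply: eq_big_seq => p ->.
Qed.

Lemma gr_diff_comp (s t : seq int) (f g : int -> C) : uniq s -> uniq t ->
  (forall p, f p \in gr C p) -> (forall p, g p \in gr C p) ->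
  (forall p, p \notin s -> f p = 0) -> (forall p, p \notin t -> g p = 0) ->
  \sum_(p <- s) f p = diff (\sum_(p <- t) g p) ->
  forall p, f p = diff (g (p - 1)).
Proof.
move=> us ut hf hg fs gt e.
have sub1K : cancel (fun p : int => p + 1) (fun p => p - 1).
  by move=> p; rewrite addrK.
apply: (@gr_sum_eq s [seq p + 1 | p <- t] f (fun p => diff (g (p - 1)))) => //.
- by rewrite map_inj_uniq //; apply: can_inj sub1K.
- by move=> p; rewrite -{2}[p](subrK 1) diff_gr.
- move=> p pt; rewrite gt ?raddf0 //; apply: contra pt => pt.
  by apply/mapP; exists (p - 1); rewrite ?subrK.
- rewrite e raddf_sum big_map; apply: eq_bigr => p _.
  by rewrite sub1K.
Qed.

Lemma coh_span (h : coh_sort) : exists (s : seq int) (f : int -> coh_sort),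
  [/\ uniq s, forall p, f p \in coh_gr p & h = \sum_(p <- s) f p].
Proof.
have [a da ->] := coh_clsP h.
have [s [f [us hf fs ea]]] := gr_decomp a.
have df p : diff (f p) = 0.
  rewrite -[p](addrK 1).
  apply/esym/(@gr_diff_comp [::] s (fun=> 0) f); rewrite ?rpred0 //.
    by move=> q; rewrite rpred0.
  by rewrite big_nil -ea da.
exists s, (fun p => coh_cls (f p)); split=> //.
  by move=> p; apply/coh_grP; exists (f p).
by rewrite ea coh_cls_sum.
Qed.

Lemma coh_indep (s : seq int) (f : int -> coh_sort) :
  uniq s -> (forall p, f p \in coh_gr p) -> \sum_(p <- s) f p = 0 ->
  forall p, p \in s -> f p = 0.
Proof.
move=> us hf e p ps.
have {}hf q : exists a, [/\ a \in gr C q, diff a = 0 & f q = coh_cls a].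
  exact/coh_grP/hf.
pose g q := if q \in s then sval (cid (hf q)) else 0.
have gg q : g q \in gr C q.
  by rewrite /g; case: ifP; rewrite ?rpred0 //; case: cid => a [].
have dg q : diff (g q) = 0.
  by rewrite /g; case: ifP; rewrite ?raddf0 //; case: cid => a [].
have fg q : q \in s -> f q = coh_cls (g q).
  by rewrite /g => ->; case: cid => a [].
have : coh_cls (\sum_(q <- s) g q) = coh_cls 0.
  rewrite coh_cls0 coh_cls_sum // -[RHS]e; apply: eq_big_seq => q qs.
  by rewrite fg.
have dsum : diff (\sum_(q <- s) g q) = 0.
  by rewrite raddf_sum; apply: big1 => i _; apply: dg.
move=> /(coh_cls_eq dsum (raddf0 _))[c]; rewrite subr0.
have [t [k [ut hk kt ->]]] := gr_decomp c.
move=> /(gr_diff_comp us ut gg hk) e'.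
rewrite fg // e' //; last by move=> q; rewrite /g => /negPf->.
rewrite -coh_cls0; apply/(coh_cls_eq (diffK _) (raddf0 _)).
by exists (k (p - 1)); rewrite subr0.
Qed.

Definition coh_gmod : gmod K := @Gmod K coh_sort coh_gr coh_span coh_indep.

Lemma coh_diff_gr p (h : coh_gmod) :
  h \in gr coh_gmod p -> (\0 : {linear _ -> _}) h \in gr coh_gmod (p + 1).
Proof. by move=> _; apply: rpred0. Qed.

(* The cohomology H(C), as a complex with zero differential. *)
Definition coh : complex K :=
  @Complex K coh_gmod \0 coh_diff_gr (fun=> erefl).

End Cohomology.
Arguments coh_cls {K C}.
Arguments cocycles {K} C.
Arguments boundaries {K} C.

(* The product is not assumed unital. *)
Record dga (K : fieldType) := Dga {
  dga_complex :> complex K;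
  dmul : {bilinear dga_complex -> dga_complex -> dga_complex};
  dmul_gr : forall p q a b,
    a \in gr dga_complex p -> b \in gr dga_complex q ->
    dmul a b \in gr dga_complex (p + q);
  dmulA : forall a b c, dmul a (dmul b c) = dmul (dmul a b) c;
  dmul_leibniz : forall p a b, a \in gr dga_complex p ->
    diff (dmul a b) = dmul (diff a) b + (-1) ^ p *: dmul a (diff b)
}.
Arguments dmul {K d}.

Section CohomologyProduct.
Variables (K : fieldType) (A : dga K).

Definition coh_rep (x : coh A) : A :=
  submod_val (repr (x : subquot (cocycles A) (boundaries A))).

Definition hmul (x y : coh A) : coh A := coh_cls (dmul (coh_rep x) (coh_rep y)).

Lemma coh_rep_cocycle x : diff (coh_rep x) = 0.
Proof. by apply/cocyclesP; apply: submod_valP. Qed.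

Lemma coh_repK x : coh_cls (coh_rep x) = x.
Proof.
rewrite /coh_cls (clsE _ (submod_valP _)) -[RHS](reprK (x : subquot _ _)).
by congr (\pi_(subquot _ _) _); apply: val_inj.
Qed.

Lemma dmul_diffl (a b : A) : diff b = 0 -> exists c, dmul (diff a) b = diff c.
Proof.
move=> db; have [s [f [_ hf ->]]] := gr_span a.
exists (dmul (\sum_(p <- s) f p) b).
rewrite raddf_sum !linear_sumlz raddf_sum /=; apply: eq_bigr => p _.
by rewrite (dmul_leibniz _ (hf p)) db linear0r scaler0 addr0.
Qed.

Lemma dmul_diffr (a b : A) : diff a = 0 -> exists c, dmul a (diff b) = diff c.
Proof.
move=> da; have [s [f [us hf fs ea]]] := gr_decomp a.
have df p : diff (f p) = 0.
  rewrite -[p](addrK 1).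
  apply/esym/(@gr_diff_comp _ _ [::] s (fun=> 0) f); rewrite ?rpred0 //.
    by move=> q; rewrite rpred0.
  by rewrite big_nil -ea da.
exists (dmul (\sum_(p <- s) (-1) ^ p *: f p) b).
rewrite ea !linear_sumlz raddf_sum /=; apply: eq_bigr => p _.
rewrite linearZl_LR linearZ (dmul_leibniz _ (hf p)) df linear0l add0r.
by rewrite /= scalerA -expfzMl mulrNN mulr1 exp1rz scale1r.
Qed.

Lemma dmul_cocycle (a b : A) : diff a = 0 -> diff b = 0 -> diff (dmul a b) = 0.
Proof.
move=> da db; have [s [f [us hf fs ea]]] := gr_decomp a.
have df p : diff (f p) = 0.
  rewrite -[p](addrK 1).
  apply/esym/(@gr_diff_comp _ _ [::] s (fun=> 0) f); rewrite ?rpred0 //.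
    by move=> q; rewrite rpred0.
  by rewrite big_nil -ea da.
rewrite ea linear_sumlz raddf_sum /=; apply: big1 => p _.
by rewrite (dmul_leibniz _ (hf p)) df db linear0l linear0r scaler0 addr0.
Qed.

Lemma hmul_cls (a b : A) : diff a = 0 -> diff b = 0 ->
  hmul (coh_cls a) (coh_cls b) = coh_cls (dmul a b).
Proof.
move=> da db; rewrite /hmul; set a' := coh_rep _; set b' := coh_rep _.
have da' : diff a' = 0 by apply: coh_rep_cocycle.
have db' : diff b' = 0 by apply: coh_rep_cocycle.
have /(coh_cls_eq da' da)[u ua] : coh_cls a' = coh_cls a by apply: coh_repK.
have /(coh_cls_eq db' db)[v vb] : coh_cls b' = coh_cls b by apply: coh_repK.
apply/(coh_cls_eq (dmul_cocycle da' db') (dmul_cocycle da db)).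
have [u' ue] := dmul_diffl u db'; have [v' ve] := dmul_diffr v da.
exists (u' + v'); rewrite raddfD /= -ue -ve -ua -vb linearBl linearBr.
by rewrite addrA subrK.
Qed.

Lemma hmul_bilinear : bilinear_for *:%R *:%R hmul.
Proof.
by split=> y k x x' /=; have [a da ->] := coh_clsP x;
   have [a' da' ->] := coh_clsP x'; have [b db ->] := coh_clsP y;
   rewrite -coh_clsP_lin // !hmul_cls ?linearP ?da ?da' ?scaler0 ?addr0 //
           -coh_clsP_lin ?dmul_cocycle // ?linearPl ?linearPr.
Qed.
HB.instance Definition _ :=
  bilinear_isBilinear.Build K (coh A) (coh A) (coh A) *:%R *:%R hmul
    hmul_bilinear.

Lemma hmul_gr p q (x y : coh A) : x \in gr (coh A) p -> y \in gr (coh A) q ->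
  hmul x y \in gr (coh A) (p + q).
Proof.
move=> /coh_grP[a [ga da ->]] /coh_grP[b [gb db ->]].
rewrite hmul_cls //; apply/coh_grP; exists (dmul a b).
by rewrite dmul_gr ?dmul_cocycle.
Qed.

End CohomologyProduct.

(* A family (f_n) of maps V^{⊗n} -> W is encoded by one function f on words:
   f_n is the restriction of f to words of length n, and tensors of operations
   act by cutting words.  The values of f on words shorter than the least arity
   m of the family are unconstrained and never used.  A word s carries a list
   ds of degrees of its letters, from which the Koszul signs are computed. *)

Section Operations.
Variable K : fieldType.
Implicit Types (ds : seq int) (n m : nat).

Definition homog (V : gmod K) ds (s : seq V) : bool :=
  all2 (fun p v => v \in gr V p) ds s.

Definition degsum ds : int := \sum_(p <- ds) p.

Record operations (V W : gmod K) (m : nat) (e : int) (f : seq V -> W) : Prop :=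
  Operations {
    operations_linear : forall (s1 s2 : seq V) (k : K) (u v : V),
      (m <= (size s1 + size s2).+1)%N ->
      f (s1 ++ (k *: u + v) :: s2) = k *: f (s1 ++ u :: s2) + f (s1 ++ v :: s2);
    (* f_n has degree e - n *)
    operations_gr : forall ds (s : seq V), (m <= size s)%N -> homog ds s ->
      f s \in gr W (degsum ds + (e - (size s)%:Z))
  }.

(* δ(f_n) = d∘f_n - (-1)^e f_n∘d evaluated on s, where e is the degree of f_n *)
Definition delta (V W : complex K) (e : int) (f : seq V -> W) ds (s : seq V) :
    W :=
  diff (f s) - (-1) ^ e *:
    \sum_(i < size s) (-1) ^ degsum (take i ds) *:
      f (take i s ++ diff (nth 0 s i) :: drop i.+1 s).

(* ∑ (-1)^{i(l+1)+n} f_k (id^{⊗(i-1)} ⊗ g_l ⊗ id^{⊗(k-i)}) evaluated on s,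
   where n = size s and g_l has degree 2 - l *)
Definition insertions (V W : gmod K) (f : seq V -> W) (g : seq V -> V) ds
    (s : seq V) : W :=
  let n := size s in
  \sum_(2 <= k < n) \sum_(1 <= i < k.+1)
    let l := (n.+1 - k)%N in
    (-1) ^+ (i * l.+1 + n) *: ((-1) ^ ((2 - l%:Z) * degsum (take i.-1 ds)) *:
      f (take i.-1 s ++ g (take l (drop i.-1 s)) :: drop (i.-1 + l) s)).

(* (f_{r_1} ⊗ ... ⊗ f_{r_k})(s), as a word; f_r has degree 1 - r *)
Definition tensor_sign (r : seq nat) ds : K :=
  (-1) ^ (\sum_(j < size r)
            (1 - (nth 0%N r j)%:Z) *
            degsum (take (\sum_(i < j) nth 0%N r i)%N ds)).
Definition tensor_word (V W : gmod K) (f : seq V -> W) (r : seq nat)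
    (s : seq V) : seq W :=
  [seq f w | w <- reshape r s].

(* ∑ (-1)^{∑_{i<j} r_i(r_j+1)} g_k (f_{r_1} ⊗ ... ⊗ f_{r_k}) evaluated on s,
   over k >= 2 and r_1 + ... + r_k = size s with all r_j >= 1 *)
Definition compositions (V W : gmod K) (g : seq W -> W) (f : seq V -> W) ds
    (s : seq V) : W :=
  let n := size s in
  \sum_(2 <= k < n.+1) \sum_(t : k.-tuple 'I_n.+1 |
      let r := [seq nat_of_ord i | i <- t] in
      (sumn r == n) && all (leq 1) r)
    let r := [seq nat_of_ord i | i <- t] in
    (-1) ^+ (\sum_(j < k) \sum_(i < j) nth 0%N r i * (nth 0%N r j).+1)%N *:
      (tensor_sign r ds *: g (tensor_word f r s)).

(* mu makes (C, d, mu_2, mu_3, ...) an A_oo-algebra *)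
Record is_ainf (C : complex K) (mu : seq C -> C) : Prop := IsAinf {
  ainf_operations : operations 2 2 mu;
  ainf_rel : forall ds (s : seq C), (2 <= size s)%N -> homog ds s ->
    delta (2 - (size s)%:Z) mu ds s = insertions mu mu ds s
}.

(* theta : (C, d, mu_2, ...) -> (D, d, nu_2, ...) is an A_oo-morphism *)
Record is_ainf_morphism (C D : complex K) (mu : seq C -> C) (nu : seq D -> D)
    (theta : seq C -> D) : Prop := IsAinfMorphism {
  ainfm_operations : operations 1 1 theta;
  ainfm_chain : forall a : C, diff (theta [:: a]) = theta [:: diff a];
  ainfm_rel : forall ds (s : seq C), (2 <= size s)%N -> homog ds s ->
    delta (1 - (size s)%:Z) theta ds s + compositions nu theta ds s
    = theta [:: mu s] - insertions theta mu ds s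
}.

Definition dga_ops (A : dga K) (s : seq A) : A :=
  if s is [:: a; b] then dmul a b else 0.

Variable A : dga K.

Lemma dga_ainf : is_ainf (@dga_ops A).
Proof.
split; first split.
- move=> [|a [|b [|c s1]]] [|a' [|b' s2]] k u v //= _;
    rewrite ?scaler0 ?addr0 //.
  + by rewrite linearPl.
  + by rewrite linearPr.
- move=> ds [|a [|b [|c s]]] //= _ h; rewrite ?rpred0 //.
  case: ds h => [|d1 [|d2 [|d3 ds]]] //=; rewrite ?andbF //.
  move=> /and3P[ga gb _]; rewrite /degsum !big_cons big_nil !addr0.
  by have := dmul_gr ga gb.
move=> ds [|a [|b [|c s]]] //= _.
  case: ds => [|d1 [|d2 [|d3 ds]]] //=; rewrite ?andbF //.
  move=> /and3P[ga gb _]; rewrite /delta /insertions /= big_geq //.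
  rewrite !big_ord_recl big_ord0 /= /degsum big_nil big_cons big_nil !addr0.
  rewrite (dmul_leibniz _ ga) subrr expr0z !scale1r.
  by rewrite subrr.
move=> _.
case: s => [|d s].
  rewrite /delta /insertions /=.
  rewrite !big_ord_recl big_ord0 /= raddf0 !scaler0 !addr0 scaler0 subr0.
  rewrite big_nat1 big_ltn // big_nat1 /=.
  rewrite subrr !mul0r !expr0z !scale1r.
  rewrite (_ : (-1) ^+ _ = 1); last by rewrite -signr_odd.
  rewrite (_ : (-1) ^+ _ = -1) ?scale1r ?scaleN1r; last by rewrite -signr_odd.
  by rewrite dmulA subrr.
have dga0 (w : seq A) : size w != 2 -> dga_ops w = 0 by case: w => [|? [|? []]].
have dga00 (u v : seq A) : dga_ops (u ++ 0 :: v) = 0.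
  case: u => [|? [|? [|? ?]]]; case: v => [|? [|? ?]] //=.
    by rewrite linear0l.
  by rewrite linear0r.
rewrite /delta /insertions /= raddf0 big1 ?scaler0 ?subr0; last first.
  move=> i _; rewrite dga0 ?scaler0 // size_cat size_take /= size_drop /=.
  by rewrite ltn_ord; have := ltn_ord i; lia.
apply/esym; rewrite big_nat_cond big1 // => k; rewrite andbT => /andP[k2 kn].
rewrite big_nat_cond big1 // => i; rewrite andbT => /andP[i1 ik].
have [ek|k2x] := eqVneq k 2; first subst k.
  rewrite (dga0 (take _ _)) ?size_take ?size_drop /=; last by case: ifP; lia.
  by rewrite dga00 !scaler0.
rewrite dga0 ?scaler0 // size_cat size_take /= size_drop /=; case: ifP; lia.
Qed.

Definition is_canonical_minimal_model (mu : seq (coh A) -> coh A) : Prop :=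
  is_ainf mu /\
  exists2 psi : seq (coh A) -> A, is_ainf_morphism mu (@dga_ops A) psi &
    forall h, coh_cls (psi [:: h]) = h.

Definition is_canonical_product n (f : n.-tuple (coh A) -> coh A) : Prop :=
  (2 <= n)%N /\ exists2 mu, is_canonical_minimal_model mu &
    forall t, f t = mu t.

Lemma canonical_product_gr n (f : n.-tuple (coh A) -> coh A) ds
    (t : n.-tuple (coh A)) : is_canonical_product f ->
  homog ds t -> f t \in gr (coh A) (degsum ds + (2 - n%:Z)).
Proof.
move=> [n2 [mu [[hmu _] _] ->]] ht.
by have := @operations_gr _ _ _ _ _ hmu ds t; rewrite size_tuple; apply.
Qed.

End Operations.

Section Massey.
Variables (K : fieldType) (A : dga K) (p q r : int) (x y z : coh A).

Definition bar (e : int) (a : A) : A := (-1) ^ e *: a.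

Record defining_system := DefiningSystem {
  a11 : A; a22 : A; a33 : A; a12 : A; a23 : A;
  a11_gr : a11 \in gr A p;
  a22_gr : a22 \in gr A q;
  a33_gr : a33 \in gr A r;
  a12_gr : a12 \in gr A (p + q - 1);
  a23_gr : a23 \in gr A (q + r - 1);
  a11_cocycle : diff a11 = 0;
  a22_cocycle : diff a22 = 0;
  a33_cocycle : diff a33 = 0;
  a11_cls : coh_cls a11 = x;
  a22_cls : coh_cls a22 = y;
  a33_cls : coh_cls a33 = z;
  a12_diff : diff a12 = dmul (bar p a11) a22;
  a23_diff : diff a23 = dmul (bar q a22) a33
}.

Definition massey_cochain (D : defining_system) : A :=
  dmul (bar p (a11 D)) (a23 D) + dmul (bar (p + q - 1) (a12 D)) (a33 D).

Definition massey : set (coh A) :=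
  [set coh_cls (massey_cochain D) | D in [set: defining_system]].

Lemma massey_cochain_cocycle (D : defining_system) :
  diff (massey_cochain D) = 0.
Proof.
rewrite /massey_cochain /bar raddfD /= !linearZl_LR /= !linearZ /=.
rewrite (dmul_leibniz _ (a11_gr D)) (dmul_leibniz _ (a12_gr D)).
rewrite a11_cocycle a33_cocycle linear0l linear0r scaler0 addr0 add0r sgnK.
rewrite a12_diff a23_diff /bar !linearZl_LR linearZr_LR /= dmulA.
rewrite scalerA -scalerDl !sgnD sgn1.
rewrite [X in _ + X](_ : _ = - (-1) ^ q) ?subrr ?scale0r //.
have e : (-1 : K) ^ p * (-1) ^ p = 1 by rewrite -expfzMl mulrNN mulr1 exp1rz.
by rewrite mulrN1 mulNr mulrAC e mul1r.
Qed.

Lemma massey_cochain_gr (D : defining_system) :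
  massey_cochain D \in gr A (p + q + r - 1).
Proof.
rewrite /massey_cochain /bar !linearZl_LR rpredD // rpredZ //.
  have := dmul_gr (a11_gr D) (a23_gr D).
  by rewrite !addrA.
have := dmul_gr (a12_gr D) (a33_gr D).
by rewrite addrAC.
Qed.

Lemma massey_gr h : h \in massey -> h \in gr (coh A) (p + q + r - 1).
Proof.
rewrite inE => -[D _ <-]; apply/coh_grP; exists (massey_cochain D).
by rewrite massey_cochain_gr massey_cochain_cocycle.
Qed.

(* x · H^{q+r-1} + H^{p+q-1} · z *)
Definition indeterminacy : {pred coh A} := fun h =>
  `[< exists u v, [/\ u \in gr (coh A) (q + r - 1),
        v \in gr (coh A) (p + q - 1) & h = hmul x u + hmul v z] >].

Lemma indeterminacyP h :
  reflect (exists u v, [/\ u \in gr (coh A) (q + r - 1),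
             v \in gr (coh A) (p + q - 1) & h = hmul x u + hmul v z])
    (h \in indeterminacy).
Proof. by rewrite unfold_in; apply: asboolP. Qed.

Lemma indeterminacy_closed : submod_closed indeterminacy.
Proof.
split=> [|k h h' /indeterminacyP[u [v [gu gv ->]]]].
  by apply/indeterminacyP; exists 0, 0; rewrite !rpred0 linear0r linear0l addr0.
move=> /indeterminacyP[u' [v' [gu' gv' ->]]]; apply/indeterminacyP.
exists (k *: u + u'), (k *: v + v'); rewrite !rpredD ?rpredZ //.
by split=> //; rewrite linearPr linearPl scalerDr addrACA.
Qed.
HB.instance Definition _ :=
  GRing.isSubmodClosed.Build K (coh A) indeterminacy indeterminacy_closed.

Definition massey_quot : lmodType K :=
  subquot (gr (coh A) (p + q + r - 1)) indeterminacy.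

Definition massey_quot_cls (h : coh A) : massey_quot :=
  cls (gr (coh A) (p + q + r - 1)) indeterminacy h.

End Massey.

(* Main.v *)
Require Import Defs.
From mathcomp Require Import all_boot all_order all_algebra.
From mathcomp Require Import zify boolp classical_sets.

Set Implicit Arguments.
Unset Strict Implicit.
Unset Printing Implicit Defensive.

Import GRing.Theory.
Local Open Scope classical_set_scope.
Local Open Scope ring_scope.

(** An [A_oo]-morphism [psi] from a canonical minimal model to [A] contains a
    defining system: the relation in arity 2 reads
    [d psi_2(x,y) = psi(xy) - psi(x) psi(y)], so that when [xy = yz = 0] the
    cochains [-(-1)^p psi_2(x,y)] and [-(-1)^q psi_2(y,z)] complete
    [psi(x), psi(y), psi(z)]; by the relation in arity 3 the associated
    cocycle is [(-1)^q (psi(mu_3(x,y,z)) - d psi_3(x,y,z))].  It remains to see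
    that the class of a defining system modulo the indeterminacy does not
    depend on it. *)

(** * Vanishing on zero letters, homogeneous primitives, compositions into a dg algebra *)

Lemma operations_zero (K : fieldType) (V W : gmod K) m e (f : seq V -> W)
    (s1 s2 : seq V) : operations m e f -> (m <= (size s1 + size s2).+1)%N ->
  f (s1 ++ 0 :: s2) = 0.
Proof.
move=> hf hm.
have := operations_linear hf (-1) 0 0 hm.
by rewrite scaler0 addr0 scaleN1r addNr.
Qed.

Lemma gr_subr (K : fieldType) (V : gmod K) p (u v : V) :
  u \in gr V p -> v \in gr V p -> u - v \in gr V p.
Proof. by move=> hu hv; rewrite -scaleN1r rpredD ?rpredZ. Qed.

(** As [diff] raises degrees by one and [a] sits in degree [p], the component of [c] in degree
    [p - 1] is already a primitive of [a]. *)
Lemma boundary_homog (K : fieldType) (C : complex K) p (a c : C) :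
  a \in gr C p -> a = diff c -> exists2 b, b \in gr C (p - 1) & a = diff b.
Proof.
move=> ga; have [t [g [ut hg gt ->]]] := gr_decomp c => e.
exists (g (p - 1)) => //.
pose f i := if i == p then a else 0.
have fp : f p = a by rewrite /f eqxx.
rewrite -fp; apply: (@gr_diff_comp _ _ [:: p] t f g) => // [i|i|].
- by rewrite /f; case: eqP => [->|_] //; apply: rpred0.
- by rewrite inE /f => /negPf->.
- by rewrite big_seq1 fp.
Qed.

Lemma compositions_dga_ops (K : fieldType) (A : dga K) (V : gmod K)
    (f : seq V -> A) ds (s : seq V) : (2 <= size s)%N ->
  compositions (@dga_ops K A) f ds s =
  \sum_(1 <= i < size s) (-1) ^+ (i * (size s - i).+1) *:
    ((-1) ^ ((1 - (size s - i)%N%:Z) * degsum (take i ds)) *: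
      dmul (f (take i s)) (f (drop i s))).
Proof.
(* Only k = 2 contributes; its 2-tuples are the [(i, n - i)]. *)
move=> s_ge2; rewrite /compositions; set n := size s.
rewrite big_ltn ?ltnS // [X in _ + X]big1_seq ?addr0; last first.
  move=> k /andP[_]; rewrite mem_index_iota => /andP[k_gt2 _].
  rewrite big1 // => t _.
  rewrite [dga_ops _](_ : _ = 0) ?scaler0 //.
  have: size (tensor_word f [seq nat_of_ord i | i <- t] s) = k.
    by rewrite !size_map size_reshape size_map size_tuple.
  by case: tensor_word => [|? [|? [|? ?]]] //=; lia.
rewrite (reindex_onto (fun i : 'I_n.+1 => [tuple i; inord (n - i)])
                      (fun t => thead t)) /=; last first.
  move=> t; case/tupleP: t => i t; case/tupleP: t => j t.
  rewrite tuple0 /= addn0 => /andP[/eqP e _]; apply: val_inj => /=.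
  rewrite theadE; congr [:: _; _]; apply: val_inj.
  by rewrite /= inordK; lia.
rewrite (big_nat_widen 1 n n.+1) // big_geq_mkord /=.
have inordB (i : 'I_n.+1) : nat_of_ord (inord (n - i) : 'I_n.+1) = (n - i)%N.
  by rewrite inordK // ltnS leq_subr.
apply: eq_big => [i|i]; rewrite !inordB.
  rewrite addn0 subnKC ?leq_ord // theadE !eqxx andbT /=; lia.
rewrite theadE => /andP[/andP[_ /and3P[i_gt0 _ _]] _].
(* The second block cut by [reshape] is all of [drop i s]. *)
rewrite (@take_oversize _ (n - i)) ?size_drop //.
(* The first factor is preceded by the empty word, so only the second contributes a Koszul sign. *)
rewrite /tensor_sign /= !big_ord_recl !big_ord0 /= ?big_ord_recl ?big_ord0 /=.
by rewrite take0 /degsum big_nil mulr0 add0r !addn0 addr0 add0n.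
Qed.

Section CohClass.
Variables (K : fieldType) (C : complex K).
Implicit Types a b : C.

Lemma coh_clsD a b : diff a = 0 -> diff b = 0 ->
  coh_cls (a + b) = coh_cls a + coh_cls b.
Proof. by move=> da db; rewrite -[a]scale1r coh_clsP_lin // !scale1r. Qed.

Lemma coh_clsZ k a : diff a = 0 -> coh_cls (k *: a) = k *: coh_cls a.
Proof.
by move=> da; rewrite -[k *: a]addr0 coh_clsP_lin ?raddf0 // coh_cls0 addr0.
Qed.

Lemma coh_clsB a b : diff a = 0 -> diff b = 0 ->
  coh_cls (a - b) = coh_cls a - coh_cls b.
Proof.
move=> da db; rewrite addrC -scaleN1r coh_clsP_lin //.
by rewrite scaleN1r addrC.
Qed.

End CohClass.

(** * Morphism relations in arities 2 and 3 *)

Section Morphism.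
Variables (K : fieldType) (A : dga K).
Variables (mu : seq (coh A) -> coh A) (psi : seq (coh A) -> A).
Hypothesis hpsi : is_ainf_morphism mu (@dga_ops K A) psi.
Let psi_op := ainfm_operations hpsi.

(** The differential of [coh A] is zero, so each term of [psi] composed with it has a zero
    letter. *)
Lemma delta_coh e ds (s : seq (coh A)) : (0 < size s)%N ->
  delta e psi ds s = diff (psi s).
Proof.
move=> s_gt0; rewrite /delta big1 ?scaler0 ?subr0 // => i _.
by rewrite (operations_zero psi_op) ?scaler0.
Qed.

(** In arity 2 there are no insertions, and the only composition has sign +1. *)
Lemma ainf_morphism_to_dga_rel2 p q x y :
    x \in gr (coh A) p -> y \in gr (coh A) q ->
  diff (psi [:: x; y]) = psi [:: mu [:: x; y]] - dmul (psi [:: x]) (psi [:: y]).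
Proof.
move=> gx gy; have := @ainfm_rel _ _ _ _ _ _ hpsi [:: p; q] [:: x; y] isT.
rewrite /= gx gy => /(_ isT); rewrite delta_coh //.
rewrite compositions_dga_ops //.
rewrite {1}/insertions (@big_geq _ _ _ 2 2) // subr0 => <-.
rewrite big_nat1 /= subSnn subrr mul0r expr0z scale1r.
by rewrite sqrrN expr1n scale1r addrK.
Qed.

(** Both insertions contain [mu [:: x; y]] or [mu [:: y; z]] and vanish. The splitting 1+2 has sign
    -(-1)^p, where (-1)^p is the Koszul sign of psi_2 passing [x]; the splitting 2+1 has sign +1. *)
Lemma ainf_morphism_to_dga_rel3 p q r x y z :
    x \in gr (coh A) p -> y \in gr (coh A) q -> z \in gr (coh A) r ->
    mu [:: x; y] = 0 -> mu [:: y; z] = 0 ->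
  diff (psi [:: x; y; z]) = psi [:: mu [:: x; y; z]]
    + (-1) ^ p *: dmul (psi [:: x]) (psi [:: y; z])
    - dmul (psi [:: x; y]) (psi [:: z]).
Proof.
move=> gx gy gz xy yz.
have := @ainfm_rel _ _ _ _ _ _ hpsi [:: p; q; r] [:: x; y; z] isT.
rewrite /= gx gy gz => /(_ isT); rewrite delta_coh //.
rewrite compositions_dga_ops //.
have ins0 : insertions psi mu [:: p; q; r] [:: x; y; z] = 0.
  rewrite /insertions /= big_nat1 big_ltn // big_nat1 /= xy yz.
  rewrite (operations_zero (s1 := [::]) psi_op) //.
  by rewrite (operations_zero (s1 := [:: x]) psi_op) // !scaler0 addr0.
rewrite ins0 subr0 => <-; rewrite big_ltn // big_nat1 /=.
rewrite -[(3 - 2)%N]/1%N -[(3 - 1)%N]/2%N subrr mul0r expr0z scale1r.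
rewrite -[_ ^+ (1 * 3)]signr_odd -[_ ^+ (2 * 2)]signr_odd /= expr0 expr1.
rewrite (_ : 1 - 2%:Z = -1) // mulN1r -exprz_inv invrN1 /degsum big_seq1.
by rewrite scaleN1r scale1r [- _ + _]addrC addrA subrK addrK.
Qed.

End Morphism.

(** * Independence of the defining system *)

(** Primitives of the differences [ai' - ai] correct [a12' - a12] and [a23' - a23] to cocycles [u]
    and [v]; up to a boundary, the two Massey cocycles differ by signed products [a1 v] and
    [u a3']. *)
Lemma massey_cls_sub_indeterminacy (K : fieldType) (A : dga K)
    (p q r : int) (x y z : coh A) (D D' : defining_system p q r x y z) :
  coh_cls (massey_cochain D') - coh_cls (massey_cochain D)
    \in indeterminacy p q r x z.
Proof.
have := massey_cochain_cocycle D; have := massey_cochain_cocycle D'.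
rewrite /massey_cochain.
case: D D' => [a1 a2 a3 a12 a23 g1 g2 g3 g12 g23 d1 d2 d3 c1 c2 c3 d12 d23].
case=> [a1' a2' a3' a12' a23' g1' g2' g3' g12' g23' d1' d2' d3' c1' c2' c3'].
move=> d12' d23' /=; set c' := (X in diff X = 0 -> _); move=> dc'.
set c := (X in diff X = 0 -> _); move=> dc.
have [b1 gb1 e1] : exists2 b, b \in gr A (p - 1) & a1' - a1 = diff b.
  have [b e] := (coh_cls_eq d1' d1).1 (etrans c1' (esym c1)).
  by apply: boundary_homog e; apply: gr_subr.
have [b2 gb2 e2] : exists2 b, b \in gr A (q - 1) & a2' - a2 = diff b.
  have [b e] := (coh_cls_eq d2' d2).1 (etrans c2' (esym c2)).
  by apply: boundary_homog e; apply: gr_subr.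
have [b3 gb3 e3] : exists2 b, b \in gr A (r - 1) & a3' - a3 = diff b.
  have [b e] := (coh_cls_eq d3' d3).1 (etrans c3' (esym c3)).
  by apply: boundary_homog e; apply: gr_subr.
(* [u] and [v] are cocycles because the differentials of the subtracted
   brackets are [bar a1' a2' - bar a1 a2] and [bar a2' a3' - bar a2 a3]. *)
pose u := a12' - a12 - (dmul a1 b2 + (-1) ^ p *: dmul b1 a2').
pose v := a23' - a23 - (dmul a2 b3 + (-1) ^ q *: dmul b2 a3').
have gu : u \in gr A (p + q - 1).
  apply: gr_subr; first exact: gr_subr.
  rewrite rpredD ?rpredZ //; first by have := dmul_gr g1 gb2; rewrite addrA.
  by have := dmul_gr gb1 g2'; rewrite addrAC.
have gv : v \in gr A (q + r - 1).
  apply: gr_subr; first exact: gr_subr.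
  rewrite rpredD ?rpredZ //; first by have := dmul_gr g2 gb3; rewrite addrA.
  by have := dmul_gr gb2 g3'; rewrite addrAC.
have sgnDl i w : (-1) ^ i *: ((-1) ^ (i - 1) *: w) = - w :> A.
  by rewrite sgnD sgn1 mulrN1 scaleNr scalerN sgnK.
have du : diff u = 0.
  rewrite /u !raddfB raddfD /= linearZ /= d12 d12'.
  rewrite (dmul_leibniz _ g1) (dmul_leibniz _ gb1) d1 d2' -e1 -e2 /bar.
  rewrite linear0l add0r linear0r scaler0 addr0 linearBr linearBl !linearZl_LR.
  by rewrite /= -scalerDr [X in _ - _ *: X]addrC subrKA scalerBr subrr.
have dv : diff v = 0.
  rewrite /v !raddfB raddfD /= linearZ /= d23 d23'.
  rewrite (dmul_leibniz _ g2) (dmul_leibniz _ gb2) d2 d3' -e2 -e3 /bar.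
  rewrite linear0l add0r linear0r scaler0 addr0 linearBr linearBl !linearZl_LR.
  by rewrite /= -scalerDr [X in _ - _ *: X]addrC subrKA scalerBr subrr.
(* Write [c' - c] through [a1' - a1 = diff b1], [a3' - a3 = diff b3] and the differences of [a12],
   [a23]. The Leibniz rule on [b1 a23'] and [a12 b3] produces the boundary; its remaining terms
   cancel the [b1] and [b3] corrections in [u] and [v], and the two [b2] corrections cancel each
   other. *)
have cE : c' - c = (-1) ^ p *: dmul a1 v + (-1) ^ (p + q - 1) *: dmul u a3'
    + diff ((-1) ^ p *: dmul b1 a23' + dmul a12 b3).
  rewrite [diff _]raddfD /= [diff (_ *: _)]linearZ /= (dmul_leibniz _ gb1).
  rewrite (dmul_leibniz _ g12).
  rewrite d12 d23' -e1 -e3 /c /c' /u /v /bar.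
  rewrite !(linearBl, linearBr, linearDl, linearDr) /=.
  rewrite !(linearZl_LR, linearZr_LR) /= !dmulA.
  rewrite !(scalerBr, scalerDr) sgnDl.
  have sgnDB1 m :
      (-1) ^ (p + q - 1) *: m = - ((-1) ^ p *: ((-1) ^ q *: m)) :> A.
    by rewrite scalerA !sgnD sgn1 mulrN1 scaleNr.
  rewrite [_ ^ (p + q - 1) *: dmul (dmul a1 b2) a3']sgnDB1.
  rewrite [_ *: (_ *: dmul (dmul b1 a2') a3')]sgnDB1.
  rewrite (scalerA ((-1) ^ q)) [(-1) ^ q * _]mulrC -scalerA sgnK.
  rewrite !(opprD, opprK) !addrA.
  (* The four terms of [c' - c] come first, then five pairs of opposite terms. *)
  rewrite [RHS](ACl (9*5*2*14*(1*10)*(3*12)*(4*7)*(6*13)*(8*11))) /=.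
  by rewrite !(subrr, addNr, addr0).
apply/indeterminacyP.
exists (coh_cls ((-1) ^ p *: v)), (coh_cls ((-1) ^ (p + q - 1) *: u)).
have dpv : diff ((-1) ^ p *: v) = 0 by rewrite linearZ /= dv scaler0.
have dpu : diff ((-1) ^ (p + q - 1) *: u) = 0 by rewrite linearZ /= du scaler0.
split.
- by apply/coh_grP; exists ((-1) ^ p *: v); rewrite rpredZ.
- by apply/coh_grP; exists ((-1) ^ (p + q - 1) *: u); rewrite rpredZ.
(* As in [cE], [x] is represented by [a1] from [D] but [z] by [a3'] from [D']. *)
rewrite -{1}c1 -{1}c3' !hmul_cls // -!coh_clsB ?dmul_cocycle //.
rewrite -coh_clsD ?dmul_cocycle //; apply/coh_cls_eq.
- by rewrite raddfB /= dc dc' subrr.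
- by rewrite raddfD /= !dmul_cocycle ?addr0.
exists ((-1) ^ p *: dmul b1 a23' + dmul a12 b3).
by rewrite cE linearZr_LR linearZl_LR /= addrC addKr.
Qed.

(** * Comparison of the two classes *)

Theorem theorem8 (K : fieldType) (A : dga K) (p q r : int) (x y z : coh A)
    (hx : x \in gr (coh A) p) (hy : y \in gr (coh A) q)
    (hz : z \in gr (coh A) r)
    (hxy : hmul x y = 0) (hyz : hmul y z = 0)
    (mu3 : 3.-tuple (coh A) -> coh A) (hmu3 : is_canonical_product mu3) :
  [set massey_quot_cls p q r x z m | m in massey p q r x y z] =
  [set (-1) ^ q *: massey_quot_cls p q r x z (mu3 [tuple x; y; z])].
Proof.
have [_ [mu [[mu_op _] [psi hpsi psiK]] ->]] := hmu3.
have psi_op := ainfm_operations hpsi.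
have dpsi h : diff (psi [:: h]) = 0.
  by rewrite (ainfm_chain hpsi) (operations_zero (s1 := [::]) psi_op).
(* The arity 2 relation forces mu_2 to be the induced product: [psi] of it and the product of the
   [psi] values differ by a boundary. *)
have mu2 i j g h : g \in gr (coh A) i -> h \in gr (coh A) j ->
    mu [:: g; h] = hmul g h.
  move=> gg gh; rewrite -[LHS]psiK -{2}[g]psiK -{2}[h]psiK hmul_cls //.
  apply/coh_cls_eq; rewrite ?dmul_cocycle //.
  by exists (psi [:: g; h]); rewrite (ainf_morphism_to_dga_rel2 hpsi gg gh).
have psi_gr i h : h \in gr (coh A) i -> psi [:: h] \in gr A i.
  move=> gh; have := @operations_gr _ _ _ _ _ _ psi_op [:: i] [:: h] isT.
  by rewrite /= gh /degsum big_seq1 subrr addr0; apply.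
have psi2_gr i j g h : g \in gr (coh A) i -> h \in gr (coh A) j ->
    psi [:: g; h] \in gr A (i + j - 1).
  move=> gg gh.
  have := @operations_gr _ _ _ _ _ _ psi_op [:: i; j] [:: g; h] isT.
  by rewrite /= gg gh /degsum big_cons big_seq1; apply.
have psi2_diff i j g h : g \in gr (coh A) i -> h \in gr (coh A) j ->
    hmul g h = 0 ->
    diff (- ((-1) ^ i *: psi [:: g; h])) =
    dmul (bar i (psi [:: g])) (psi [:: h]).
  move=> gg gh gh0; rewrite raddfN /= linearZ /=.
  rewrite (ainf_morphism_to_dga_rel2 hpsi gg gh) (mu2 _ _ _ _ gg gh) gh0.
  rewrite (operations_zero (s1 := [::]) psi_op) //.
  by rewrite sub0r scalerN opprK linearZl_LR.
have gr_psi2 i j g h : g \in gr (coh A) i -> h \in gr (coh A) j ->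
    - ((-1) ^ i *: psi [:: g; h]) \in gr A (i + j - 1).
  by move=> gg gh; rewrite -scaleNr rpredZ ?psi2_gr.
pose D := DefiningSystem (psi_gr _ _ hx) (psi_gr _ _ hy) (psi_gr _ _ hz)
  (gr_psi2 _ _ _ _ hx hy) (gr_psi2 _ _ _ _ hy hz) (dpsi x) (dpsi y) (dpsi z)
  (psiK x) (psiK y) (psiK z) (psi2_diff _ _ _ _ hx hy hxy)
  (psi2_diff _ _ _ _ hy hz hyz).
have massey_gr' h : massey p q r x y z h -> h \in gr (coh A) (p + q + r - 1).
  by move=> hh; apply: (@massey_gr _ _ _ _ _ x y z); rewrite inE.
have mu3E : (-1) ^ q *: mu [:: x; y; z] = coh_cls (massey_cochain D).
  rewrite -{1}[mu _]psiK -coh_clsZ //.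
  apply/coh_cls_eq; rewrite ?massey_cochain_cocycle //.
    by rewrite linearZ /= dpsi scaler0.
  (* In [massey_cochain D] the coefficient of psi_2(x,y) psi(z) is -(-1)^(p+q-1) (-1)^p = (-1)^q and
     that of psi(x) psi_2(y,z) is -(-1)^(p+q), which is the arity 3 relation scaled by (-1)^q. *)
  exists ((-1) ^ q *: psi [:: x; y; z]).
  rewrite linearZ /= (ainf_morphism_to_dga_rel3 hpsi hx hy hz)
    ?(mu2 p q x y) ?(mu2 q r y z) //.
  rewrite /massey_cochain /= /bar.
  rewrite !(linearZl_LR, linearNl, linearNr, linearZr_LR) /=.
  rewrite !scalerN !sgnD sgn1 mulrN1 scaleNr opprK [_ * (-1) ^ q]mulrC.
  rewrite -[(_ * _) *: _]scalerA sgnK opprD opprK scalerBr scalerDr.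
  by rewrite addrA !scalerA [(-1) ^ q * _]mulrC.
have gD : coh_cls (massey_cochain D) \in gr (coh A) (p + q + r - 1).
  by apply: massey_gr'; exists D.
have quotE : massey_quot_cls p q r x z (coh_cls (massey_cochain D)) =
             (-1) ^ q *: massey_quot_cls p q r x z (mu [:: x; y; z]).
  (* [clsZ] requires [mu [:: x; y; z]] to lie in the right degree; this follows from [gD] by undoing
     the sign. *)
  by rewrite -mu3E /massey_quot_cls clsZ // -[mu _](sgnK q) rpredZ // mu3E.
(* The inclusion of the singleton is witnessed by [D], which also shows that the Massey product is
   nonempty; the other inclusion compares any [D'] with [D]. *)
apply/seteqP; split=> [_ [_ [D' _ <-] <-] | _ ->] /=; last first.
  by exists (coh_cls (massey_cochain D)) => //; exists D.
rewrite -[RHS]quotE.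
apply/cls_eq; last exact: massey_cls_sub_indeterminacy; last by [].
by apply: massey_gr'; exists D'.
Qed.
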